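(* Let $a\ge b\ge 2$ be integers. If the spider $S(a,b,2)$ is $e$-positive, then \[a\in\bigcup_{q=1}^{b-2}\{m\in\mathbb N:\ (b+2)q\le m\le (b+1)q+b-2\}.\] Moreover, if $a\equiv 0\pmod 3$ and $b\equiv 1\pmod 3$, then $a\le 2b+4$. *)

(* Defs.v *)
From mathcomp Require Import all_boot all_algebra.
From mathcomp Require Import mpoly.
Set Implicit Arguments. Unset Strict Implicit. Unset Printing Implicit Defensive.
Import GRing.Theory.
Local Open Scope ring_scope.

(* Spider S(a,b,c): vertices 0 .. a+b+c, 0 is the centre; legs are the paths
   1-2-...-a, (a+1)-...-(a+b), (a+b+1)-...-(a+b+c), each attached to 0 by
   its first vertex. Leg lengths = number of non-centre vertices in the leg. *)
Definition spider_edge0 (a b : nat) (u v : nat) : bool :=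
  ((v == u.+1) && (u != a) && (u != a + b))%N
  || ((u == 0) && ((v == a.+1) || (v == (a + b).+1)))%N.

Definition spider_edge (a b c : nat) (u v : 'I_(a + b + c).+1) : bool :=
  spider_edge0 a b u v || spider_edge0 a b v u.

Definition proper_col (a b c : nat)
    (k : {ffun 'I_(a + b + c).+1 -> 'I_(a + b + c).+1}) : bool :=
  [forall u, forall v, @spider_edge a b c u v ==> (k u != k v)].

(* Chromatic symmetric function of S(a,b,c) in N = |V| variables
   (which determines it: it is homogeneous of degree N). *)
Definition chrom_spider (a b c : nat) : {mpoly rat[(a + b + c).+1]} :=
  \sum_(k | proper_col k) \prod_(v : 'I_(a + b + c).+1) 'X_(k v).

(* Partitions of n encoded by multiplicities: m i = multiplicity of part i+1 *)
Definition is_partition (n : nat) (m : {ffun 'I_n -> 'I_n.+1}) : bool :=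
  (\sum_(i < n) i.+1 * m i == n)%N.

Definition e_part (N n : nat) (m : {ffun 'I_n -> 'I_n.+1}) : {mpoly rat[N]} :=
  \prod_(i < n) (mesym N rat i.+1) ^+ (m i).

(* e-positivity of a homogeneous degree-N symmetric function, given in N variables *)
Definition e_positive (N : nat) (f : {mpoly rat[N]}) : Prop :=
  exists c : {ffun 'I_N -> 'I_N.+1} -> rat,
    (forall m, 0 <= c m) /\
    f = \sum_(m | is_partition m) c m *: e_part N m.

Definition spider_e_positive (a b c : nat) : Prop :=
  e_positive (chrom_spider a b c).

(* Main.v *)
(** Write [P_n] for the chromatic symmetric function of the path on [n] vertices.
    Peeling off the shortest leg gives, with [N = a + b + 3],
      X(S(a,b,2)) = P_2 P_(N-2) - P_(b+1) P_(a+2) + P_1 P_(N-1) - P_(b+2) P_(a+1) + P_N,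
    and [P_n = e_n + sum_(k >= 1) k e_(k+1) P_(n-k-1)] for [n > 0].  The elementary
    symmetric polynomials are algebraically independent, so an [e]-positive
    function stays nonnegative when the [e_k] are replaced by polynomials with
    nonnegative coefficients.

    With [e_(b+1) = e_(b+2) = 1] and all other [e_k = 0], the spider becomes
    [- P_(a+2) - P_(a+1)], which is negative as soon as [N] is a sum of parts [b+1]
    and [b+2], that is, unless [N mod (b+1) > N div (b+1)]; this is the first claim.
    For the second one, the coefficient of [e_4 e_3^((N-4)/3)] is negative when
    [a > 2 b + 4]. *)
Require Import Defs.
From mathcomp Require Import all_boot all_order all_algebra.
From mathcomp Require Import mpoly zify ring lra.
Set Implicit Arguments. Unset Strict Implicit. Unset Printing Implicit Defensive.
Import Order.TTheory GRing.Theory Num.Theory.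
Local Open Scope ring_scope.

(** * The path recurrence over an arbitrary commutative ring *)

Section PathRecurrence.
Variable R : comNzRingType.
Implicit Type e : nat -> R.

(* The list [:: P_n; ...; P_0], most recent value first. *)
Fixpoint path_table e (n : nat) : seq R :=
  if n is m.+1 then
    let s := path_table e m in
    (e m.+1 + \sum_(k < m.+1) k%:R * e k.+1 * s`_k) :: s
  else [:: 1].

Definition path_e e n : R := (path_table e n)`_0.

Lemma nth_path_table e n k : (k <= n)%N -> (path_table e n)`_k = path_e e (n - k).
Proof.
elim: n k => [|n IHn] [|k] //= le_kn; rewrite ?subn0 //.
by rewrite IHn.
Qed.

Lemma path_eS e n : path_e e n.+1 =
  e n.+1 + \sum_(k < n.+1) k%:R * e k.+1 * path_e e (n - k).
Proof.
rewrite {1}/path_e /=; congr (_ + _); apply: eq_bigr => k _.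
by rewrite nth_path_table // -ltnS.
Qed.

Lemma path_e_unique e (P : nat -> R) : P 0 = 1 ->
  (forall n, P n.+1 = e n.+1 + \sum_(k < n.+1) k%:R * e k.+1 * P (n - k)%N) ->
  P =1 path_e e.
Proof.
move=> P0 PS n; elim/ltn_ind: n => -[_|n IHn]; first by rewrite P0.
rewrite PS path_eS; congr (_ + _); apply: eq_bigr => k _.
by rewrite IHn // ltnS leq_subr.
Qed.

End PathRecurrence.

Lemma rmorph_path_e (R S : comNzRingType) (f : {rmorphism R -> S}) (e : nat -> R) n :
  f (path_e e n) = path_e (f \o e) n.
Proof.
apply: (path_e_unique (P := fun n => f (path_e e n))) => [|{}n].
  by rewrite rmorph1.
rewrite path_eS rmorphD rmorph_sum; congr (_ + _); apply: eq_bigr => k _.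
by rewrite !rmorphM rmorph_nat.
Qed.

(** The recurrence only reads [e] at successors, so [e 0] is free. *)
Lemma eq_path_e (R : comNzRingType) (e1 e2 : nat -> R) n :
  (forall k, (0 < k)%N -> e1 k = e2 k) -> path_e e1 n = path_e e2 n.
Proof.
move=> eq_e; apply: path_e_unique => // {}n.
by rewrite path_eS eq_e //; congr (_ + _); apply: eq_bigr => k _; rewrite eq_e.
Qed.

Definition spider_e (R : comNzRingType) (e : nat -> R) (a b : nat) : R :=
  path_e e 2 * path_e e (a + b + 1) - path_e e b.+1 * path_e e a.+2
  + path_e e 1 * path_e e (a + b + 2) - path_e e b.+2 * path_e e a.+1
  + path_e e (a + b + 3).

(** * Weighted colourings of paths and spiders *)

Section Walks.
Variables (R : comNzRingType) (I : finType) (x : I -> R).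

(* Weighted count of the proper colourings of an [n]-vertex path hanging from a
   vertex of colour [i], without the weight of that vertex. *)
Fixpoint leg n i : R :=
  if n is m.+1 then \sum_(j | i != j) x j * leg m j else 1.

Definition path_x n : R := if n is m.+1 then \sum_i x i * leg m i else 1.

Lemma legS n i : leg n.+1 i = path_x n.+1 - x i * leg n i.
Proof.
rewrite /= [in RHS](bigD1 i) //= [RHS]addrAC subrr add0r.
by apply: eq_bigl => j; rewrite eq_sym.
Qed.

Lemma leg0 i : leg 0 i = 1. Proof. by []. Qed.

Lemma sum_leg n : \sum_i x i * leg n i = path_x n.+1. Proof. by []. Qed.

(** Two legs glued at their common root form a path; by [legS], moving a vertex from one leg to the
    other leaves the sum unchanged. *)
Lemma sum_leg_leg n m : \sum_i x i * leg n i * leg m i = path_x (n + m).+1.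
Proof.
elim: m n => [|m IHm] n.
  by rewrite addn0; apply: eq_bigr => i _; rewrite mulr1.
rewrite addnS -addSn -IHm.
under eq_bigr => i _ do rewrite legS mulrBr.
rewrite sumrB -mulr_suml sum_leg.
under [RHS]eq_bigr => i _ do rewrite legS mulrBr mulrBl.
rewrite sumrB; congr (_ - _).
  rewrite -(sum_leg m) mulr_sumr; apply: eq_bigr => i _; ring.
by apply: eq_bigr => i _; ring.
Qed.

(** Each [step] moves one vertex from the third leg to the second. After two steps the third leg is
    empty and a path remains. *)
Lemma sum_leg_leg2 a b : \sum_i x i * leg a i * leg b i * leg 2 i =
  path_x 2 * path_x (a + b + 1) - path_x b.+1 * path_x a.+2
  + path_x 1 * path_x (a + b + 2) - path_x b.+2 * path_x a.+1
  + path_x (a + b + 3).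
Proof.
have step c b' : \sum_i x i * leg a i * leg b' i * leg c.+1 i =
    path_x c.+1 * path_x (a + b').+1 - path_x b'.+1 * path_x (a + c).+1
    + \sum_i x i * leg a i * leg b'.+1 i * leg c i.
  rewrite -!sum_leg_leg !mulr_sumr -sumrB -big_split; apply: eq_bigr => i _.
  by rewrite !legS /=; ring.
rewrite !step; under eq_bigr => i _ do rewrite leg0 mulr1.
rewrite sum_leg_leg !addnS !addn0; ring.
Qed.

(* Colourings are read as words listing the colours in vertex order: the centre,
   then the three legs, so that the sum over colourings factors by concatenation. *)
Fixpoint words_sum n (F : seq I -> R) : R :=
  if n is m.+1 then \sum_i words_sum m (fun s => F (i :: s)) else F [::].

Lemma eq_words_sum n F G : (forall s, size s = n -> F s = G s) ->
  words_sum n F = words_sum n G.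
Proof.
elim: n F G => [|n IHn] F G eqFG /=; first exact: eqFG.
by apply: eq_bigr => i _; apply: IHn => s size_s; apply: eqFG; rewrite /= size_s.
Qed.

Lemma words_sumM n c F : words_sum n (fun s => c * F s) = c * words_sum n F.
Proof.
elim: n F => [|n IHn] F //=; rewrite mulr_sumr.
by apply: eq_bigr => i _; rewrite IHn.
Qed.

Lemma words_sumD m n F :
  words_sum (m + n) F = words_sum m (fun s => words_sum n (fun t => F (s ++ t))).
Proof. by elim: m F => [|m IHm] F //=; apply: eq_bigr => i _; rewrite IHm. Qed.

Lemma words_sum_tuple n (F : seq I -> R) : \sum_(t : n.-tuple I) F t = words_sum n F.
Proof.
elim: n F => [|n IHn] F /=.
  rewrite (big_pred1 [tuple]) // => t; apply/esym/eqP; exact: tuple0.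
under [RHS]eq_bigr => i _ do rewrite -IHn.
rewrite pair_big /=.
rewrite (reindex (fun p : I * n.-tuple I => [tuple of p.1 :: p.2])) //=.
exists (fun t => (thead t, [tuple of behead t])) => [[i t] _|t _] /=.
  by rewrite theadE; congr (_, _); apply/val_inj.
by rewrite -tuple_eta.
Qed.

Lemma words_sum_ffun n F :
  \sum_(k : {ffun 'I_n -> I}) F [seq k i | i <- enum 'I_n] = words_sum n F.
Proof.
rewrite -words_sum_tuple.
rewrite (reindex (fun t : n.-tuple I => [ffun i => tnth t i])) /=.
  apply: eq_bigr => t _; congr F.
  rewrite -[RHS]map_tnth_enum; apply: eq_map => i; exact: ffunE.
exists (fun k : {ffun 'I_n -> I} => [tuple k i | i < n]) => [t _|k _].
  by apply: eq_from_tnth => i; rewrite tnth_mktuple ffunE.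
by apply/ffunP => i; rewrite ffunE tnth_mktuple.
Qed.

Definition proper_word (i : I) (s : seq I) : bool := path (fun c d => c != d) i s.

Lemma words_sum_leg n i :
  words_sum n (fun s => (proper_word i s)%:R * \prod_(c <- s) x c) = leg n i.
Proof.
elim: n i => [|n IHn] i; first by rewrite /= big_nil mulr1.
rewrite /= [RHS]big_mkcond; apply: eq_bigr => j _.
case: ifP => ij.
  rewrite -IHn -words_sumM; apply: eq_words_sum => s _.
  by rewrite big_cons; ring.
(* A repeated colour kills every word; the form [0 * 0] lets [words_sumM] pull out a factor 0. *)
rewrite (@eq_words_sum _ _ (fun=> 0 * 0)) => [|s _].
  by rewrite (words_sumM _ _ (fun=> 0)) mul0r.
by rewrite !mul0r.
Qed.

End Walks.

(** The legs are consecutive blocks after the centre, so an edge is either a consecutive pair within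
    a leg or joins the centre to the first letter of a leg. *)
Lemma spider_wordP (I : finType) a b (i : I) (s1 s2 s3 : seq I) :
  size s1 = a -> size s2 = b ->
  reflect (forall u v, (u < (a + b + size s3).+1)%N -> (v < (a + b + size s3).+1)%N ->
             spider_edge0 a b u v ->
             nth i (i :: s1 ++ s2 ++ s3) u != nth i (i :: s1 ++ s2 ++ s3) v)
    [&& proper_word i s1, proper_word i s2 & proper_word i s3].
Proof.
move=> size1 size2; set w := i :: _.
have w1 k : (k <= a)%N -> nth i w k = nth i (i :: s1) k.
  by move=> ka; rewrite /w -cat_cons nth_cat /= size1 ltnS ka.
have w2 k : (k < b)%N -> nth i w (a + k).+1 = nth i s2 k.
  move=> kb; rewrite /w /= nth_cat size1 ltnNge leq_addr /= addKn.
  by rewrite nth_cat size2 kb.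
have w3 k : nth i w (a + b + k).+1 = nth i s3 k.
  rewrite /w /= nth_cat size1 -addnA ltnNge leq_addr /= addKn.
  by rewrite nth_cat size2 ltnNge leq_addr /= addKn.
have w0 : nth i w 0 = i by [].
clearbody w.
apply: (iffP and3P) => [[/(pathP i) p1 /(pathP i) p2 /(pathP i) p3] u v|pw].
  rewrite size1 in p1; rewrite size2 in p2.
  move=> lt_u lt_v /orP[/andP[/andP[/eqP v_u u_a] u_ab]|/andP[/eqP-> /orP[]/eqP v_a]];
    subst v.
  - have [lt_ua|le_au] := ltnP u a.
      by rewrite !w1 // 1?ltnW //; apply: p1.
    have [lt_uab|le_abu] := ltnP u (a + b).
      have [k def_u] : exists k, u = (a + k).+1 by exists (u - a).-1; lia.
      have lt_k : (k.+1 < b)%N by lia.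
      by move: (p2 _ lt_k); rewrite /= -(w2 _ (ltnW lt_k)) -(w2 _ lt_k) addnS -def_u.
    have [k def_u] : exists k, u = (a + b + k).+1 by exists (u - (a + b)).-1; lia.
    have lt_k : (k.+1 < size s3)%N by lia.
    by move: (p3 _ lt_k); rewrite /= -!w3 addnS -def_u.
  (* If the second leg is empty, position [a.+1] is already the start of the third. *)
  - have [b0|lt0b] := posnP b; last first.
      by move: (p2 0%N lt0b); rewrite /= -w2 // addn0 w0.
    have lt0c : (0 < size s3)%N by lia.
    by move: (p3 0%N lt0c); rewrite /= -w3 b0 !addn0 w0.
  - have lt0c : (0 < size s3)%N by lia.
    by move: (p3 0%N lt0c); rewrite /= -w3 !addn0 w0.
split; apply/(pathP i) => k; rewrite ?size1 ?size2 => lt_k.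
- rewrite -w1 1?ltnW //; have /= <- := w1 _ lt_k.
  by apply: pw; rewrite /spider_edge0; lia.
- rewrite -w2 //; case: k lt_k => [|k] lt_k /=.
    by rewrite addn0 -{1}w0; apply: pw; rewrite /spider_edge0; lia.
  by rewrite -w2 1?ltnW //; apply: pw; rewrite /spider_edge0; lia.
rewrite -w3 //; case: k lt_k => [|k] lt_k /=.
  by rewrite addn0 -{1}w0; apply: pw; rewrite /spider_edge0; lia.
by rewrite -w3; apply: pw; rewrite /spider_edge0; lia.
Qed.

Lemma proper_colP a b c (k : {ffun 'I_(a + b + c).+1 -> 'I_(a + b + c).+1}) x0 :
  let w := [seq k v | v <- enum 'I_(a + b + c).+1] in
  reflect (forall u v, (u < (a + b + c).+1)%N -> (v < (a + b + c).+1)%N ->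
             spider_edge0 a b u v -> nth x0 w u != nth x0 w v)
    (proper_col k).
Proof.
move=> w; have nth_w (v : 'I_(a + b + c).+1) : nth x0 w v = k v.
  by rewrite (nth_map v) ?nth_ord_enum // size_enum_ord.
apply: (iffP forallP) => [prop u v lt_u lt_v edge_uv|prop u].
  rewrite -[u]/(val (Ordinal lt_u)) -[v]/(val (Ordinal lt_v)) !nth_w.
  move/forallP: (prop (Ordinal lt_u)) => /(_ (Ordinal lt_v)) /implyP; apply.
  by rewrite /spider_edge edge_uv.
apply/forallP => v; apply/implyP => /orP[] edge; rewrite -!nth_w.
  exact: prop.
by rewrite eq_sym; apply: prop.
Qed.

(** Once the centre has its colour [i], the three legs are coloured independently. *)
Lemma chrom_spiderE a b c : chrom_spider a b c =
  \sum_i 'X_i * leg (fun i => 'X_i) a i * leg (fun i => 'X_i) b i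
    * leg (fun i => 'X_i) c i.
Proof.
pose N := (a + b + c).+1; pose x i : {mpoly rat[N]} := 'X_i.
pose F (w : seq 'I_N) : {mpoly rat[N]} :=
  let i := head ord0 w in let s1 := take a (behead w) in
  let s2 := take b (drop a (behead w)) in let s3 := drop b (drop a (behead w)) in
  [&& proper_word i s1, proper_word i s2 & proper_word i s3]%:R * \prod_(d <- w) x d.
have ->: chrom_spider a b c = words_sum N F.
  rewrite -words_sum_ffun /chrom_spider big_mkcond /=; apply: eq_bigr => k _.
  set w := map _ _.
  have size_w : size w = N by rewrite size_map size_enum_ord.
  rewrite /F big_map enumT -/(index_enum _).
  suff ->: proper_col k = [&& proper_word (head ord0 w) (take a (behead w)),
      proper_word (head ord0 w) (take b (drop a (behead w)))
    & proper_word (head ord0 w) (drop b (drop a (behead w)))].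
    by case: ifP => _; rewrite ?mul1r ?mul0r.
  have def_w : w = head ord0 w :: take a (behead w) ++
      take b (drop a (behead w)) ++ drop b (drop a (behead w)).
    by rewrite !cat_take_drop; case: (w) size_w.
  have size3 : size (drop b (drop a (behead w))) = c.
    by rewrite !size_drop size_behead size_w /N /=; lia.
  have size1 : size (take a (behead w)) = a.
    by rewrite size_takel // size_behead size_w /N /=; lia.
  have size2 : size (take b (drop a (behead w))) = b.
    by rewrite size_takel // size_drop size_behead size_w /N /=; lia.
  have := spider_wordP (head ord0 w) (drop b (drop a (behead w))) size1 size2.
  rewrite -def_w size3 => spiderP.
  by apply/(proper_colP k (head ord0 w))/spiderP.
apply: eq_bigr => i _; rewrite -/x -/N.
transitivity (words_sum (a + (b + c)) (fun s => F (i :: s))).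
  by rewrite addnA.
rewrite words_sumD.
(* The leg to be expanded next goes last, so that the remaining factors can be pushed under its sum
   over words. *)
rewrite [RHS](_ : _ = x i * leg x b i * leg x c i * leg x a i); last by rewrite /x; ring.
rewrite -(words_sum_leg x a) -words_sumM; apply: eq_words_sum => s1 size1.
set y1 := (X in _ = _ * X).
rewrite words_sumD [RHS](_ : _ = x i * leg x c i * y1 * leg x b i); last by ring.
rewrite -(words_sum_leg x b) -words_sumM; apply: eq_words_sum => s2 size2.
set y2 := (X in _ = _ * X).
rewrite [RHS](_ : _ = x i * y1 * y2 * leg x c i); last by ring.
rewrite -(words_sum_leg x c) -words_sumM; apply: eq_words_sum => s3 size3.
rewrite {}/y1 {}/y2.
rewrite /F /= take_size_cat // drop_size_cat // take_size_cat // drop_size_cat //.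
rewrite !big_cons !big_cat /=.
by do 3!case: (proper_word _ _) => /=; ring.
Qed.

(** * Elementary symmetric functions and the path recurrence *)

Section ElementarySymmetric.
Variables (R : comNzRingType) (I : finType) (x : I -> R).

Definition esym k : R := \sum_(h : {set I} | #|h| == k) \prod_(i in h) x i.

Definition esym_avoid i k : R :=
  \sum_(h : {set I} | (#|h| == k) && (i \notin h)) \prod_(j in h) x j.

Lemma esym0 : esym 0 = 1.
Proof.
rewrite /esym (big_pred1 set0) ?big_set0 // => h; exact: cards_eq0.
Qed.

Lemma esym_avoid0 i : esym_avoid i 0 = 1.
Proof.
rewrite /esym_avoid (big_pred1 set0) ?big_set0 // => h /=.
by rewrite cards_eq0; case: eqP => // ->; rewrite inE.
Qed.

Lemma sum_mem_esym i k :
  \sum_(h : {set I} | (#|h| == k.+1) && (i \in h)) \prod_(j in h) x j =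
  x i * esym_avoid i k.
Proof.
rewrite (reindex_onto (fun h => i |: h) (fun h => h :\ i)) /=; last first.
  by move=> h /andP[_ ih]; rewrite setD1K.
rewrite /esym_avoid mulr_sumr; apply: eq_big => [h|h /andP[_ /eqP eq_h]].
  rewrite setU11 andbT cardsU1; have [ih|nih] /= := boolP (i \in h).
    rewrite andbF; apply/negbTE/nandP; right; apply: contraL ih => /eqP <-.
    by rewrite !inE eqxx.
  by rewrite setU1K // eqxx !andbT.
by rewrite big_setU1 //= -eq_h !inE eqxx.
Qed.

Lemma esymS i k : esym k.+1 = esym_avoid i k.+1 + x i * esym_avoid i k.
Proof. by rewrite -sum_mem_esym /esym (bigID (fun h : {set I} => i \in h)) addrC. Qed.

(** Double counting of pairs [i \in h]: a set of size [k.+1] occurs once for each of its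
    elements. *)
Lemma sum_esym_avoid k : \sum_i x i * esym_avoid i k = k.+1%:R * esym k.+1.
Proof.
under eq_bigr => i _ do rewrite -sum_mem_esym big_mkcondr /=.
rewrite exchange_big mulr_sumr; apply: eq_bigr => h /eqP card_h.
by rewrite -big_mkcond sumr_const card_h mulr_natl.
Qed.

(** With generating functions L_i of [leg] and E_i of [esym_avoid i], [legS] gives (1 + x_i z) L_i =
    P and [esymS] gives E = (1 + x_i z) E_i, hence E L_i = E_i P. *)
Lemma esym_leg i n :
  \sum_(k < n.+1) esym k * leg x (n - k) i =
  \sum_(k < n.+1) esym_avoid i k * path_x x (n - k).
Proof.
case: n => [|n]; first by rewrite !big_ord1 esym0 esym_avoid0.
rewrite big_ord_recl [RHS]big_ord_recr subnn esym0 -(esym_avoid0 i) subn0 [path_x x 0]/=.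
under eq_bigr => k _ do rewrite lift0 subSS (esymS i) mulrDl.
rewrite big_split addrA.
transitivity (\sum_(k < n.+2) esym_avoid i k * leg x (n.+1 - k) i
   + \sum_(k < n.+1) x i * esym_avoid i k * leg x (n - k) i).
  by rewrite [X in _ = X + _]big_ord_recl; congr (_ + _ + _).
rewrite [X in X + _ = _]big_ord_recr /= subnn addrAC -big_split /=; congr (_ + _).
apply: eq_bigr => k _; rewrite subSn -1?ltnS // legS; ring.
Qed.

(* Summing [esym_leg] against [x i] gives E P = E + z E' P for the generating
   functions of [esym] and [path_x], that is, P = E / (E - z E'). *)
Lemma path_xE n : path_x x n = path_e esym n.
Proof.
apply: path_e_unique => // {}n.
have: \sum_i x i * (\sum_(k < n.+1) esym k * leg x (n - k) i) =
      \sum_i x i * (\sum_(k < n.+1) esym_avoid i k * path_x x (n - k)).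
  by apply: eq_bigr => i _; rewrite esym_leg.
under eq_bigr => i _ do rewrite mulr_sumr.
under [in RHS]eq_bigr => i _ do rewrite mulr_sumr.
rewrite exchange_big [RHS]exchange_big /=.
under eq_bigr => k _ do [under eq_bigr => i _ do rewrite mulrCA;
  rewrite -mulr_sumr sum_leg].
under [in RHS]eq_bigr => k _ do [under eq_bigr => i _ do rewrite mulrA;
  rewrite -mulr_suml sum_esym_avoid -natr1 !mulrDl mul1r].
have ->: \sum_(k < n.+1) esym k * path_x x (n - k).+1 =
    path_x x n.+1 + \sum_(k < n) esym k.+1 * path_x x (n - k).
  rewrite big_ord_recl subn0 esym0 mul1r; congr (_ + _).
  by apply: eq_bigr => k _; rewrite lift0 subnSK.
(* The factor [k.+1] was split as k + 1; the sum with coefficient 1 cancels against the left side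
   except for its last term, [esym n.+1]. *)
rewrite big_split [X in _ = _ + X]big_ord_recr subnn mulr1.
by rewrite -sum_leg => /(canRL (addrK _)) -> /=; ring.
Qed.

End ElementarySymmetric.

(** * Specializing the elementary symmetric polynomials *)

Lemma rmorph_spider_e (R S : comNzRingType) (f : {rmorphism R -> S}) e a b :
  f (spider_e e a b) = spider_e (f \o e) a b.
Proof.
by rewrite /spider_e rmorphD rmorphB rmorphD rmorphB !rmorphM !rmorph_path_e.
Qed.

Lemma eq_spider_e (R : comNzRingType) (e1 e2 : nat -> R) a b :
  (forall k, (0 < k)%N -> e1 k = e2 k) -> spider_e e1 a b = spider_e e2 a b.
Proof. by move=> eq_e; rewrite /spider_e !(eq_path_e _ eq_e). Qed.

Lemma chrom_spider2E a b : chrom_spider a b 2 = spider_e (mesym _ rat) a b.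
Proof. by rewrite chrom_spiderE sum_leg_leg2 !path_xE. Qed.

Lemma e_positive_specialize a b (e : nat -> {poly rat}) :
  spider_e_positive a b 2 ->
  (forall k, e k \is a polyOver Num.Def.nneg_num_pred) ->
  (forall k, (a + b + 2 < k.-1)%N -> e k = 0) ->
  spider_e e a b \is a polyOver Num.Def.nneg_num_pred.
Proof.
rewrite /spider_e_positive /e_positive chrom_spider2E; set N := _.+1.
move=> [c [c_ge0 def_chrom]] e_ge0 e_large.
(* Free variables in place of the [mesym] polynomials. Ordinals start at 0, whence [k.-1]; the
   default 0 matches the vanishing of [mesym] beyond [N]. *)
pose E k : {mpoly rat[N]} := if insub k.-1 is Some i then 'X_i else 0.
pose F := [tuple mesym N rat i.+1 | i < N].
have FE k : (0 < k)%N -> comp_mpoly F (E k) = mesym N rat k.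
  case: k => // k _; rewrite /E /=; case: insubP => [i _ <-|k_large].
    by rewrite comp_mpolyXU -tnth_nth tnth_mktuple.
  by rewrite rmorph0 mesym_geqnE // ltnS leqNgt.
pose h (i : 'I_N) := e i.+1.
have hE k : (0 < k)%N -> mmap (@polyC rat) h (E k) = e k.
  case: k => // k _; rewrite /E /=; case: insubP => [i _ <-|k_large].
    by rewrite mmapX mmap1U.
  by rewrite rmorph0 e_large // -ltnS ltnNge.
pose X m : {mpoly rat[N]} := \prod_(i < N) 'X_i ^+ (m : {ffun 'I_N -> 'I_N.+1}) i.
have def_E : spider_e E a b = \sum_(m | is_partition m) c m *: X m.
  apply: (@msym_fundamental_un N rat).
  rewrite -/F rmorph_spider_e (eq_spider_e _ _ FE) def_chrom.
  rewrite raddf_sum; apply: eq_bigr => m _; rewrite /= comp_mpolyZ; congr (_ *: _).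
  rewrite rmorph_prod; apply: eq_bigr => i _.
  by rewrite rmorphXn /= comp_mpolyXU -tnth_nth tnth_mktuple.
rewrite -(eq_spider_e _ _ hE) -rmorph_spider_e def_E raddf_sum.
apply: rpred_sum => m _; rewrite /= mmapZ; apply: rpredM.
  rewrite polyOverC; exact: c_ge0.
rewrite rmorph_prod; apply: rpred_prod => i _.
by rewrite rmorphXn /= mmapX mmap1U; apply/rpredX/e_ge0.
Qed.

(** * Two consecutive part sizes, and the first claim *)

Definition two_parts (R : nmodType) c (s t : R) k : R :=
  if k == c.+1 then s else if k == c.+2 then t else 0.

Section TwoParts.
Variables (R : comNzRingType) (c : nat) (s t : R).
Let P := path_e (two_parts c s t).

Lemma path_two_parts n : P n.+1 = two_parts c s t n.+1
  + (if (c <= n)%N then c%:R * s * P (n - c) else 0)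
  + (if (c < n)%N then c.+1%:R * t * P (n - c.+1) else 0).
Proof.
rewrite /P path_eS -addrA; congr (_ + _).
rewrite -(big_ord1_eq +%R (fun k => k%:R * s * P (n - k)) c n.+1).
rewrite -(big_ord1_eq +%R (fun k => k%:R * t * P (n - k)) c.+1 n.+1).
rewrite [X in _ = X + _]big_mkcond [X in _ = _ + X]big_mkcond.
rewrite -big_split; apply: eq_bigr => k _ /=.
rewrite /two_parts !eqSS; case: eqP => [->|_].
  by rewrite ltn_eqF // addr0.
by rewrite add0r; case: eqP => // _; rewrite mulr0 mul0r.
Qed.

Lemma path_two_parts_small n : (0 < n <= c)%N -> P n = 0.
Proof.
case: n => // n /= lt_nc; rewrite path_two_parts leqNgt lt_nc ltnNge ltnW //=.
by rewrite /two_parts !addr0 !eqSS !ltn_eqF // ltnW.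
Qed.

Lemma path_two_parts1 : P c.+1 = c.+1%:R * s.
Proof.
rewrite path_two_parts /two_parts eqxx leqnn ltnn subnn /P /path_e /=.
by ring.
Qed.

Lemma path_two_parts2 : (0 < c)%N -> P c.+2 = c.+2%:R * t.
Proof.
move=> c_gt0; rewrite path_two_parts /two_parts eqxx leqnSn ltnSn subnn subSn //.
rewrite subnn (path_two_parts_small (n := 1)) // {1}/P /path_e /= gtn_eqF //.
by ring.
Qed.

(** For [n > 0] the index exceeds [c.+2], so the inhomogeneous term of the recurrence vanishes. *)
Lemma path_two_partsD n : (0 < n)%N ->
  P (n + c).+2 = c%:R * s * P n.+1 + c.+1%:R * t * P n.
Proof.
move=> n_gt0; have -> : (n + c).+2 = (n.+1 + c).+1 by [].
have e0 : two_parts c s t (n.+1 + c).+1 = 0.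
  by rewrite /two_parts; case: eqP => [|_]; [lia|case: eqP => //; lia].
rewrite path_two_parts e0 add0r leq_addl addnK.
by rewrite addSn ltnS leq_addl subSS addnK.
Qed.

End TwoParts.

Lemma path_e_ge0 (R : numDomainType) (e : nat -> R) n :
  (forall k, 0 <= e k) -> 0 <= path_e e n.
Proof.
move=> e_ge0; elim/ltn_ind: n => -[_|n IHn]; first exact: ler01.
rewrite path_eS addr_ge0 // sumr_ge0 // => k _.
by rewrite !mulr_ge0 ?ler0n // IHn // ltnS leq_subr.
Qed.

(** Starting from P_0 = 1, adding a part [c.+1] or [c.+2] preserves positivity; the first case needs
    the coefficient [c] to be positive. *)
Lemma path_two_parts_gt0 (R : numDomainType) c x y : (0 < c)%N ->
  0 < path_e (two_parts c (1 : R) 1) (x * c.+1 + y * c.+2).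
Proof.
move=> c_gt0; set e := two_parts _ _ _.
have e_ge0 k : 0 <= e k by rewrite /e /two_parts; do 2?case: ifP; rewrite ?ler01.
have P_ge0 n := path_e_ge0 n e_ge0.
have step1 n : 0 < path_e e n -> 0 < path_e e (c.+1 + n).
  move=> Pn_gt0; rewrite addSn path_two_parts leq_addr addKn -/e.
  apply: ltr_wpDr; first by case: ifP => _ //; rewrite !mulr_ge0.
  by apply: ltr_wpDl => //; rewrite mulr1 mulr_gt0 // ltr0n.
have step2 n : 0 < path_e e n -> 0 < path_e e (c.+2 + n).
  move=> Pn_gt0; rewrite addSn path_two_parts leq_addr addKn -/e.
  apply: ltr_wpDl; last by rewrite mulr1 mulr_gt0 // ltr0n.
  by rewrite addr_ge0 //; case: ifP => _ //; rewrite !mulr_ge0.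
elim: x => [|x IHx]; last by rewrite mulSn -addnA; apply: step1.
elim: y => [|y IHy]; first exact: ltr01.
by rewrite [(y.+1 * _)%N]mulSn addnCA; apply: step2.
Qed.

Lemma frobenius_succ c n : (n %% c.+1 <= n %/ c.+1)%N ->
  exists x y, n = (x * c.+1 + y * c.+2)%N.
Proof.
(* Take the quotient many parts [c.+1] and enlarge as many of them by 1 as the remainder
   requires. *)
move=> le_mod_div; exists (n %/ c.+1 - n %% c.+1)%N, (n %% c.+1)%N.
by rewrite [LHS](divn_eq n c.+1); nia.
Qed.

Lemma e_positive_mod_gt_div a b : (2 <= b)%N -> (b <= a)%N ->
  spider_e_positive a b 2 -> ((a + b + 3) %/ b.+1 < (a + b + 3) %% b.+1)%N.
Proof.
move=> b_ge2 le_ba e_pos; rewrite ltnNge; apply/negP => /frobenius_succ[x [y def_N]].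
have b_gt0 : (0 < b)%N by apply: leq_trans b_ge2.
pose e := two_parts b (1 : rat) 1.
have e_ge0 k : 0 <= e k by rewrite /e /two_parts; do 2?case: ifP.
have: spider_e (polyC \o e) a b \is a polyOver Num.Def.nneg_num_pred.
  apply: e_positive_specialize => // k; first by rewrite polyOverC; apply: e_ge0.
  rewrite /= /e /two_parts => k_large.
  by case: eqP => [|_]; [lia|case: eqP => // ?; lia].
rewrite -rmorph_spider_e polyOverC => spider_ge0.
have {spider_ge0} : 0 <= spider_e e a b := spider_ge0.
have := path_two_parts_gt0 rat x y b_gt0; rewrite -def_N.
have -> : (a + b + 3 = (a.+1 + b).+2)%N by lia.
rewrite path_two_partsD // => PN_gt0.
have Pa1 := path_e_ge0 a.+1 e_ge0; have Pa2 := path_e_ge0 a.+2 e_ge0.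
rewrite /spider_e.
have -> : (a + b + 3 = (a.+1 + b).+2)%N by lia.
rewrite path_two_partsD // path_two_parts1 path_two_parts2 //.
have -> : path_e (two_parts b (1 : rat) 1) 1 = 0 by apply: path_two_parts_small.
have -> : path_e (two_parts b (1 : rat) 1) 2 = 0 by apply: path_two_parts_small.
rewrite -/e -!natr1 in PN_gt0 *.
have b_ge0 : 0 <= b%:R :> rat by [].
move=> spider_ge0.
(* The spider is now - P_(a+2) - P_(a+1), so both terms vanish, and with them P_N. *)
have [P1_0 P2_0] : path_e e a.+1 = 0 /\ path_e e a.+2 = 0 by lra.
by rewrite P1_0 P2_0 !mulr0 addr0 ltxx in PN_gt0.
Qed.

(** * Parts of size 3 and 4, and the second claim *)

Section ThreesAndFours.
Let e : nat -> {poly rat} := two_parts 2 1 'X.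
Let P : nat -> {poly rat} := path_e e.

Lemma coef_path34S n : (P n.+4.+1)`_0 = 2%:R * (P n.+2)`_0 /\
  (P n.+4.+1)`_1 = 2%:R * (P n.+2)`_1 + 3%:R * (P n.+1)`_0.
Proof.
have -> : P n.+4.+1 = 2%:R * P n.+2 + 3%:R * ('X * P n.+1).
  have := path_two_partsD 2 (1 : {poly rat}) 'X (ltn0Sn n).
  by rewrite addn2 /P /e => ->; ring.
move: (P n.+2) (P n.+1) => p q.
by rewrite !coefD !mulr_natl !coefMn !coefXM mul0rn addr0.
Qed.

(** With j parts 4 and all others 3, the size is j mod 3, which explains the zeros. The last value
    solves u_(n+1) = 2 u_n + 9 * 2^n with u_0 = 4. *)
Lemma coef_path34 n :
  [/\ (P (3 * n).+1)`_0 = 0, (P (3 * n).+2)`_0 = 0,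
      (P (3 * n).+3)`_0 = 3%:R * 2%:R ^+ n & (P (3 * n).+4)`_0 = 0] /\
  [/\ (P (3 * n).+2)`_1 = 0, (P (3 * n).+3)`_1 = 0 &
    (P (3 * n).+4)`_1 = 2%:R ^+ n * (4%:R + 9%:R / 2%:R * n%:R)].
Proof.
elim: n => [|n [[A1 A2 A3 A4] [B2 B3 B4]]].
  have P1 : P 1 = 0 by apply: path_two_parts_small.
  have P2 : P 2 = 0 by apply: path_two_parts_small.
  have P3 : P 3 = 3%:R by rewrite /P path_two_parts1 mulr1.
  have P4 : P 4 = 'X *+ 4 by rewrite /P path_two_parts2 // mulr_natl.
  rewrite muln0 P1 P2 P3 P4 !coef0 !coefMn !coefX !coefC /=.
  by rewrite mulr0 addr0 expr0 mulr1 mul1r.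
have -> : (3 * n.+1 = (3 * n).+3)%N by lia.
have [A5 B5] := coef_path34S (3 * n); have [A6 B6] := coef_path34S (3 * n).+1.
have [A7 B7] := coef_path34S (3 * n).+2.
rewrite A4 A5 A6 A7 B5 B6 B7 A1 A2 A3 A4 B2 B3 B4 exprS -natr1.
by split; split; field.
Qed.

(* As [e_3 = 1] and [e_4 = 'X], this is the coefficient of [e_3^(A+B) e_4]. *)
Lemma coef_spider34 A B : (0 < A)%N ->
  (spider_e e (3 * A) (3 * B).+1)`_1 =
  2%:R ^+ (A + B) * (19%:R + 18%:R * B%:R - 9%:R * A%:R) / 4%:R.
Proof.
case: A => // A _.
have P1 : P 1 = 0 by apply: path_two_parts_small.
have P2 : P 2 = 0 by apply: path_two_parts_small.
have -> : spider_e e (3 * A.+1) (3 * B).+1 = P (3 * (A.+1 + B)).+4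
    - P (3 * B).+2 * P (3 * A.+1).+2 - P (3 * B).+3 * P (3 * A).+4.
  rewrite /spider_e -/P P1 P2 !mul0r.
  have -> : (3 * A.+1 + (3 * B).+1 + 3 = (3 * (A.+1 + B)).+4)%N by lia.
  have -> : ((3 * A.+1).+1 = (3 * A).+4)%N by lia.
  by ring.
have [_ [_ _ BN]] := coef_path34 (A.+1 + B).
have [[_ Ab1 Ab2 _] [Bb1 Bb2 _]] := coef_path34 B.
have [[_ _ _ Aa1] [_ _ Ba1]] := coef_path34 A.
have coef1M (p q : {poly rat}) : (p * q)`_1 = p`_0 * q`_1 + p`_1 * q`_0.
  by rewrite coefM big_ord_recr big_ord1.
(* [P (3 * B).+2] has no terms of degree 0 or 1, so the first product drops out. *)
rewrite !coefB BN !coef1M Ab1 Bb1 Ab2 Bb2 Aa1 Ba1.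
by rewrite addSn exprS exprD; field.
Qed.

End ThreesAndFours.

Lemma e_positive_mod3_bound a b : (2 <= b)%N -> (b <= a)%N ->
  spider_e_positive a b 2 -> (a %% 3 = 0)%N -> (b %% 3 = 1)%N -> (a <= 2 * b + 4)%N.
Proof.
move=> b_ge2 le_ba e_pos a_mod3 b_mod3; rewrite leqNgt; apply/negP => lt_a.
have [A def_a] : exists A, a = (3 * A)%N by exists (a %/ 3)%N; lia.
have [B def_b] : exists B, b = (3 * B).+1 by exists (b %/ 3)%N; lia.
(* This makes 19 + 18 B - 9 A at most -8. *)
have le_BA : (2 * B + 3 <= A)%N by lia.
have : spider_e (two_parts 2 (1 : {poly rat}) 'X) a b \is a polyOver Num.Def.nneg_num_pred.
  apply: e_positive_specialize => // k; rewrite /two_parts.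
    case: eqP => _; first exact: rpred1.
    by case: eqP => _; [apply: polyOverX | apply: rpred0].
  by move=> k_large; case: eqP => [|_]; [lia|case: eqP => // ?; lia].
move/polyOverP/(_ 1%N); rewrite def_a def_b coef_spider34; last by lia.
move=> coef_ge0.
have {coef_ge0} : 0 <= 2%:R ^+ (A + B) * (19%:R + 18%:R * B%:R - 9%:R * A%:R) / 4%:R :> rat.
  exact: coef_ge0.
rewrite pmulr_lge0 // pmulr_rge0 ?exprn_gt0 //.
have : (2 * B + 3)%:R <= A%:R :> rat by rewrite ler_nat.
by rewrite natrD natrM; lra.
Qed.

Local Close Scope ring_scope.

Theorem theorem4p3 (a b : nat) (hb : (2 <= b)%N) (hab : (b <= a)%N)
  (hpos : spider_e_positive a b 2) :
  (exists q : nat, [/\ (1 <= q)%N, (q <= b - 2)%N,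
                      ((b + 2) * q <= a)%N & (a <= (b + 1) * q + b - 2)%N])
  /\ ((a %% 3 = 0)%N -> (b %% 3 = 1)%N -> (a <= 2 * b + 4)%N).
Proof.
split; last exact: e_positive_mod3_bound.
have lt_QR := e_positive_mod_gt_div hb hab hpos.
have lt_R : (a + b + 3) %% b.+1 < b.+1 by rewrite ltn_mod.
have := divn_eq (a + b + 3) b.+1; move: lt_QR lt_R.
set Q := (_ %/ _); set R := (_ %% _); clearbody Q R => lt_QR lt_R def_N.
have Q_ge2 : 2 <= Q by nia.
(* With q = Q - 1, [def_N] reads a = (b + 1) q + R - 2; the bounds follow from q + 2 <= R <= b. *)
exists Q.-1; case: Q Q_ge2 lt_QR def_N => // q q_ge1 lt_QR def_N /=.
by split; nia.
Qed.
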